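(* Let $(A_1A_2A_3A_4,g)$ be a $(q,l)$-pair and let $\{i,j,k,s\}=\{1,2,3,4\}$. Then the two vertices $A_i,A_j$ and the four Sharygin's points $M_{ij}^k,M_{ij}^s,M_{ji}^k,M_{ji}^s$ connected with them lie on a conic section.
   Context: The ambient plane is the extended Euclidean plane, i.e. the Euclidean plane complemented with its points at infinity and its line at infinity $\omega$ (a model of the real projective plane). $XY$ denotes the line joining points $X,Y$, and $a\cap b$ the intersection point of lines $a,b$. A complete quadrangle $A_1A_2A_3A_4$ is a set of four points, no three collinear, together with the six lines $A_pA_q$; its diagonal points are $A_1A_2\cap A_3A_4$, $A_1A_3\cap A_2A_4$, $A_1A_4\cap A_2A_3$. A $(q,l)$-pair $(A_1A_2A_3A_4,g)$ consists of a complete quadrangle and a line $g$ of its plane (possibly $g=\omega$) which is not incident with any vertex nor with any of the diagonal points. Put $U_{pq}=U_{qp}=g\cap A_pA_q$ ($p\neq q$). The four Sharygin's points associated with $A_i,A_j$ are $M_{ij}^k=A_iU_{js}\cap A_jA_k$, $M_{ji}^s=A_jU_{ik}\cap A_iA_s$, $M_{ij}^s=A_iU_{jk}\cap A_jA_s$, $M_{ji}^k=A_jU_{is}\cap A_iA_k$. *)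

(* Defs.v *)
From HB Require Import structures.
From mathcomp Require Import all_boot all_order all_algebra.
From mathcomp Require Import reals.

Set Implicit Arguments.
Unset Strict Implicit.
Unset Printing Implicit Defensive.

Import Order.TTheory GRing.Theory Num.Theory.

Local Open Scope ring_scope.

(* The extended Euclidean plane in homogeneous coordinates: its
   points and lines are the subspaces of dimension 1 and 2 of R^3.  The affine
   point (x, y) is the span of (x, y, 1), the points at infinity are the spans
   of the nonzero (x, y, 0), and the line at infinity is the subspace z = 0.
   Incidence is inclusion. *)
Definition subspace (R : realType) := {vspace 'rV[R]_3}.

Definition is_point (R : realType) (X : subspace R) : Prop := \dim X = 1%N.

Definition is_line (R : realType) (l : subspace R) : Prop := \dim l = 2.

(* The line XY when X and Y are distinct points. *)
Definition join (R : realType) (X Y : subspace R) : subspace R := (X + Y)%VS.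

(* The common point of a and b when they are distinct lines. *)
Definition meet (R : realType) (a b : subspace R) : subspace R :=
  (a :&: b)%VS.

Definition collinear (R : realType) (X Y Z : subspace R) : Prop :=
  exists l : subspace R,
    [/\ is_line l, (X <= l)%VS, (Y <= l)%VS & (Z <= l)%VS].

Definition complete_quadrangle (R : realType) (A : 'I_4 -> subspace R) : Prop :=
  (forall p, is_point (A p)) /\
  (forall p q r, uniq [:: p; q; r] -> ~ collinear (A p) (A q) (A r)).

Definition ql_pair (R : realType) (A : 'I_4 -> subspace R) (g : subspace R) :
    Prop :=
  [/\ complete_quadrangle A,
      is_line g,
      forall p, ~ (A p <= g)%VS &
      forall p q r t, uniq [:: p; q; r; t] ->
        ~ (meet (join (A p) (A q)) (join (A r) (A t)) <= g)%VS].

Definition U (R : realType) (A : 'I_4 -> subspace R) (g : subspace R)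
    (p q : 'I_4) : subspace R :=
  meet g (join (A p) (A q)).

(* M_{ij}^k; the argument s is the index left over by i, j, k. *)
Definition sharygin (R : realType) (A : 'I_4 -> subspace R) (g : subspace R)
    (i j k s : 'I_4) : subspace R :=
  meet (join (A i) (U A g j s)) (join (A j) (A k)).

(* Degenerate conics are included, and have to be: with g at infinity, if the
   line A_i A_j bisects the segment A_k A_s, then the only conic through the six
   points of the theorem is a pair of distinct lines, one of them A_i A_j. *)
Definition conic_section (R : realType) (C : subspace R -> Prop) : Prop :=
  exists Q : 'M[R]_3,
    [/\ Q^T = Q, Q != 0 &
        forall X, C X <->
          is_point X /\ forall x, x \in X -> x *m Q *m x^T = 0].

(* Main.v *)
Require Import Defs.
From HB Require Import structures.
From mathcomp Require Import all_boot all_order all_algebra.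
From mathcomp Require Import reals.
From mathcomp Require Import boolp ring.

Set Implicit Arguments.
Unset Strict Implicit.
Unset Printing Implicit Defensive.

Import Order.TTheory GRing.Theory Num.Theory.

Local Open Scope ring_scope.

(** As no vertex lies on [g], vectors [v p] spanning the vertices can be scaled so
that all the differences [v p - v q] lie in [g]: for [g] at infinity this is
the normalisation of the third homogeneous coordinate to 1.  Four vectors in
dimension 3 satisfy a relation [\sum_p w p *: v p = 0].  Reading it modulo [g]
gives [\sum_p w p = 0], and the absence of collinear triples makes every [w p]
nonzero ([exists_weighted_frame]).

Splitting this relation into two parts gives the points of the figure.  The
diagonal point on [A_p A_q] is [w p *: v p + w q *: v q], so it avoids [g]
exactly when [w p + w q != 0] ([pair_weight_neq0]); [U_pq] is [v p - v q]; and
from [(w j + w s) *: v j + w k *: v k = - w i *: v i + w s *: (v j - v s)],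
whose sides lie on [A_j A_k] and on [A_i U_js], one reads off [M_ij^k]
([sharygin_vector]).

In coordinates [(x, y, z)] with respect to [v i, v j, v k], the conics through
[A_i] and [A_j] are [p xy + r yz + t xz + q zz = 0].  The points [M_ij^k] and
[M_ji^k], which have [x = 0] and [y = 0] respectively, force [q : r : t] to be
[(w i + w k)(w j + w k) : w k (w j + w k) : w k (w i + w k)].  The other two
points, [(- w i, w k, - w k)] and [(w k, - w j, - w k)], then impose the same
condition [p = r + t]: this coincidence is the theorem.  The conic does not
contain [A_k], because [q != 0] by the condition on the diagonal points, so its
equation is not identically zero. *)

(** * Subspaces and collinearity *)

(** Used to turn a degenerate join of three points, of whatever dimension, into
an actual line containing them. *)
Lemma exists_vspace_dim (K : fieldType) (vT : vectType K) (V : {vspace vT}) m :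
  (\dim V <= m <= \dim {:vT})%N ->
  exists W : {vspace vT}, (V <= W)%VS /\ \dim W = m.
Proof.
case/andP=> Vm mT.
pose X := vbasis V ++ vbasis V^C.
have freeX : free X.
  rewrite cat_free !(basis_free (vbasisP _)) /=.
  by apply/directv_addP; rewrite !(span_basis (vbasisP _)) capv_compl.
have sizeX : size X = \dim {:vT}.
  by rewrite size_cat !size_tuple dimv_compl subnKC // dimvS ?subvf.
exists <<take m X>>%VS; split.
  rewrite -{1}(span_basis (vbasisP V)); apply: sub_span => x xV.
  rewrite take_cat size_tuple; case: ltnP => [|_].
    by rewrite ltnNge Vm.
  by rewrite mem_cat xV.
have : free (take m X).
  by move: freeX; rewrite -{1}(cat_take_drop m X); apply: catl_free.
by move/eqnP->; rewrite size_takel // sizeX.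
Qed.

(** Two distinct lines meet in any nonzero vector they share.  Distinctness is
witnessed by [u], so that nothing has to be known of the dimension of [W]. *)
Lemma capv_vline (K : fieldType) (vT : vectType K) (V W : {vspace vT}) u v :
  (\dim V <= 2)%N -> u \in V -> u \notin W -> v \in V -> v \in W -> v != 0 ->
  (V :&: W)%VS = <[v]>%VS.
Proof.
move=> dimV uV uW vV vW v0; apply/eqP; rewrite eq_sym eqEdim.
rewrite -memvE memv_cap vV vW dim_vline v0 /=.
rewrite -ltnS; apply: leq_trans dimV; rewrite ltnNge; apply: contra uW => le.
have /eqP capE : (V :&: W == V)%VS by rewrite eqEdim capvSl.
by move: uV; rewrite -capE memv_cap => /andP[].
Qed.

Lemma dim_join_leq2 (R : realType) (u v : 'rV[R]_3) :
  (\dim (join <[u]>%VS <[v]>%VS) <= 2)%N.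
Proof.
apply: leq_trans (leq_of_leqif (dimv_add_leqif _ _)) _; rewrite !dim_vline.
by case: (u != 0); case: (v != 0).
Qed.

Lemma not_collinear_dim (R : realType) (u v x : 'rV[R]_3) :
  ~ collinear <[u]>%VS <[v]>%VS <[x]>%VS ->
  (2 < \dim (<[u]> + <[v]> + <[x]>))%N.
Proof.
move=> ncol; rewrite ltnNge; apply/negP => le2; apply: ncol.
have [] := @exists_vspace_dim _ _ (<[u]> + <[v]> + <[x]>)%VS 2.
  by rewrite le2 dimvf dim_matrix.
move=> l [sub diml]; exists l; split=> //; apply: subv_trans sub.
- by rewrite -addvA addvSl.
- exact: subv_trans (addvSr _ _) (addvSl _ _).
- exact: addvSr.
Qed.

Lemma not_collinear_notin (R : realType) (u v x : 'rV[R]_3) :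
  ~ collinear <[u]>%VS <[v]>%VS <[x]>%VS -> u \notin join <[v]>%VS <[x]>%VS.
Proof.
move/not_collinear_dim; rewrite ltnNge; apply: contra => uvx.
rewrite -addvA; apply: leq_trans (dim_join_leq2 v x).
by apply: dimvS; rewrite subv_add -memvE uvx subvv.
Qed.

Lemma not_collinear_basis (R : realType) (u v x : 'rV[R]_3) :
  ~ collinear <[u]>%VS <[v]>%VS <[x]>%VS -> basis_of fullv [:: u; v; x].
Proof.
move/not_collinear_dim => gt2.
have spanE : <<[:: u; v; x]>>%VS = (<[u]> + <[v]> + <[x]>)%VS.
  by rewrite !span_cons span_nil addv0 addvA.
have /eqP full : <<[:: u; v; x]>>%VS == fullv.
  by rewrite eqEdim subvf spanE dimvf dim_matrix.
by rewrite basisEdim full subvv dimvf dim_matrix.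
Qed.

(** * The weighted frame of a quadrangle *)

Lemma quadrangle_completion (p q : 'I_4) :
  p != q -> exists r t, uniq [:: p; q; r; t].
Proof.
move=> pq.
have /eqP/cards2P [r [t [rt E]]] : #|~: [set p; q]| = 2.
  by rewrite cardsCs setCK cards2 pq card_ord.
have : r \notin [set p; q] by rewrite -in_setC E set21.
have : t \notin [set p; q] by rewrite -in_setC E set22.
rewrite !inE !negb_or => /andP[tp tq] /andP[rp rq]; exists r, t.
by rewrite /= !inE !negb_or rt pq !(eq_sym p) !(eq_sym q) rp rq tp tq.
Qed.

Lemma sum_ord4 (V : zmodType) (F : 'I_4 -> V) i j k s :
  uniq [:: i; j; k; s] -> \sum_p F p = F i + F j + F k + F s.
Proof.
move=> Hu; rewrite -!addrA -[F s]addr0.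
have -> : \sum_p F p = \sum_(p <- [:: i; j; k; s]) F p.
  rewrite -[LHS]big_enum; apply: perm_big.
  apply: uniq_perm => //; first exact: enum_uniq.
  have [||_ eqs] := uniq_min_size Hu (s2 := enum 'I_4).
  - by move=> p _; rewrite mem_enum.
  - by rewrite -cardE card_ord.
  by move=> p; rewrite eqs.
by rewrite !big_cons big_nil.
Qed.

(** The normalisation relative to [g]: [u] fixes the coset of [g] in which the
spanning vector is chosen. *)
Lemma point_vector (R : realType) (X g : subspace R) (u : 'rV[R]_3) :
  is_point X -> is_line g -> ~ (X <= g)%VS -> u \notin g ->
  exists v, X = <[v]>%VS /\ v - u \in g.
Proof.
move=> dX dg Xg ug.
have full : (<[u]> + g)%VS = fullv.
  apply/eqP; rewrite eqEdim subvf dimvf dim_matrix ltnNge /=.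
  apply: contra ug => le.
  have /eqP E : (g == <[u]> + g)%VS by rewrite eqEdim addvSr dg.
  by rewrite E memvE addvSl.
have [x xX xg] : exists2 x, x \in X & x \notin g.
  by apply/subvPn/negP.
have : x \in (<[u]> + g)%VS by rewrite full memvf.
case/memv_addP=> y /vlineP[c ->] [z zg xE].
have c0 : c != 0 by apply: contraNneq xg => c0; rewrite xE c0 scale0r add0r.
have x0 : x != 0 by apply: contraNneq xg => ->; rewrite mem0v.
exists (c^-1 *: x); split.
  apply/eqP; rewrite eq_sym eqEdim -memvE memvZ // dX dim_vline.
  by rewrite scaler_eq0 invr_eq0 negb_or c0 x0.
by rewrite xE scalerDr scalerA mulVf // scale1r addrC addKr memvZ.
Qed.

(** Homogeneous coordinates adapted to the quadrangle and to [g].  All four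
vertices enter symmetrically, so that one computation serves for every choice
of the indices [i, j, k, s]. *)
Record weighted_frame (R : realType) (A : 'I_4 -> subspace R) (g : subspace R)
    (v : 'I_4 -> 'rV[R]_3) (w : 'I_4 -> R) : Prop := WeightedFrame {
  frame_vertex : forall p, A p = <[v p]>%VS;
  frame_sub : forall p q, v p - v q \in g;
  frame_relation : \sum_p w p *: v p = 0;
  frame_weight_sum : \sum_p w p = 0;
  frame_weight_neq0 : forall p, w p != 0 }.

(** The weights come from the linear dependence of four vectors in dimension 3.
If one of them were zero, any other nonzero one would put its vertex on the line
joining the remaining two. *)
Lemma exists_weighted_frame (R : realType) (A : 'I_4 -> subspace R)
    (g : subspace R) :
  ql_pair A g -> exists v w, weighted_frame A g v w.
Proof.
case=> [[pts ncol] dg Ag _].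
have [u uA ug] : exists2 u, u \in A ord0 & u \notin g.
  by apply/subvPn/negP; apply: Ag.
have [v Hv] := fin_all_exists (fun p => point_vector (pts p) dg (@Ag p) ug).
have vA p : A p = <[v p]>%VS by have [] := Hv p.
have vg p q : v p - v q \in g.
  have vu r : v r - u \in g by have [] := Hv r.
  by rewrite -[v p](subrK u) -addrA rpredD // -opprB rpredN.
have vNg p : v p \notin g by apply/negP => vpg; apply: (Ag p); rewrite vA -memvE.
have [w rel [p0 wp0]] : exists2 w : 'I_4 -> R,
    \sum_p w p *: v p = 0 & exists p, w p != 0.
  have : ~~ free [tuple v p | p < 4].
    apply/negP => /eqnP E.
    have := dimvS (subvf <<[tuple v p | p < 4]>>%VS).
    by rewrite E size_tuple dimvf dim_matrix.
  move/negP=> nfree; apply: contrapT => H; apply: nfree; apply/freeP => w Hw p.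
  apply/eqP; apply/negP => /negP wp; apply: H; exists w; last by exists p.
  by rewrite -[RHS]Hw; apply: eq_bigr => q _; rewrite -tnth_nth tnth_mktuple.
exists v, w; split=> //.
  (* The relation read modulo [g], where all the [v p] coincide. *)
  have H : (\sum_p w p) *: v ord0 \in g.
    have -> : (\sum_p w p) *: v ord0 = - \sum_p w p *: (v p - v ord0).
      under [X in - X]eq_bigr do rewrite scalerBr.
      by rewrite sumrB rel sub0r opprK scaler_suml.
    by rewrite rpredN rpred_sum // => p _; rewrite rpredZ.
  apply/eqP; apply: contraNT (vNg ord0) => c0.
  by rewrite -(scale1r (v ord0)) -(mulVf c0) -scalerA rpredZ.
move=> p; apply: contraNneq wp0 => wp.
have [<-|pp0] := eqVneq p p0; first by rewrite wp.
have [r [t Hu]] := quadrangle_completion pp0.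
have : v p0 \notin join <[v r]>%VS <[v t]>%VS.
  apply: not_collinear_notin; rewrite -!vA.
  by apply: ncol; case/andP: Hu.
move: rel; rewrite (sum_ord4 _ Hu) wp scale0r add0r -addrA => /eqP.
rewrite addr_eq0 => /eqP E; apply: contraNT => c0.
rewrite -(scale1r (v p0)) -(mulVf c0) -scalerA E rpredZ // rpredN.
by apply: memv_add; rewrite rpredZ ?memv_line.
Qed.

(** * The points of the figure in the weighted frame *)

Lemma vertices_notin (R : realType) (A : 'I_4 -> subspace R) (g : subspace R) v w
    p q r :
  ql_pair A g -> weighted_frame A g v w -> uniq [:: p; q; r] ->
  v p \notin join <[v q]>%VS <[v r]>%VS.
Proof.
case=> [[_ ncol] _ _ _] fr Hu; apply: not_collinear_notin.
by rewrite -!(frame_vertex fr); apply: ncol.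
Qed.

Lemma pair_neq0 (R : realType) (A : 'I_4 -> subspace R) (g : subspace R) v w
    p q x y :
  ql_pair A g -> weighted_frame A g v w -> p != q -> y != 0 ->
  x *: v p + y *: v q != 0.
Proof.
move=> ql fr pq y0; have [r [t Hu]] := quadrangle_completion pq.
have Hu' : uniq [:: q; p; r].
  by move: Hu; rewrite /= !inE !negb_or (eq_sym q p) => /and4P[/and3P[-> -> _] /andP[-> _] _ _].
apply: contraNneq (vertices_notin ql fr Hu') => /eqP.
rewrite addrC addr_eq0 => /eqP E.
rewrite -(scale1r (v q)) -(mulVf y0) -scalerA E rpredZ // rpredN.
by rewrite rpredZ // memvE addvSl.
Qed.

(** The diagonal point [A_p A_q :&: A_r A_t] is spanned by [w p *: v p + w q *: v q].
If [w p + w q] were zero, this would be a multiple of [v p - v q], hence on [g]. *)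
Lemma pair_weight_neq0 (R : realType) (A : 'I_4 -> subspace R)
    (g : subspace R) v w p q r t :
  ql_pair A g -> weighted_frame A g v w -> uniq [:: p; q; r; t] ->
  w p + w q != 0.
Proof.
move=> ql fr Hu; apply/negP; rewrite addr_eq0 => /eqP wpq.
have [_ _ _ /(_ _ _ _ _ Hu)] := ql; apply; rewrite !(frame_vertex fr).
have Hu3 : uniq [:: p; r; t].
  by move: Hu; rewrite /= !inE !negb_or => /and4P[/and3P[_ -> ->] _ -> _].
have pq : p != q by move: Hu; rewrite /= !inE !negb_or => /and4P[/and3P[]].
rewrite /meet (@capv_vline _ _ _ _ (v p) (w p *: v p + w q *: v q)).
- rewrite -memvE wpq scaleNr addrC -scalerBr rpredZ //; exact: frame_sub fr _ _.
- exact: dim_join_leq2.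
- by rewrite memvE addvSl.
- exact: vertices_notin ql fr Hu3.
- by apply: memv_add; rewrite rpredZ ?memv_line.
- have /eqP := frame_relation fr; rewrite (sum_ord4 _ Hu) -addrA addr_eq0.
  by move/eqP->; rewrite rpredN; apply: memv_add; rewrite rpredZ ?memv_line.
- exact: pair_neq0 ql fr pq (frame_weight_neq0 fr q).
Qed.

Lemma U_vector (R : realType) (A : 'I_4 -> subspace R) (g : subspace R) v w
    p q :
  ql_pair A g -> weighted_frame A g v w -> p != q ->
  U A g p q = <[v p - v q]>%VS.
Proof.
move=> ql fr pq; have [_ _ Ag _] := ql.
rewrite /U /meet capvC !(frame_vertex fr); apply: (@capv_vline _ _ _ _ (v p)).
- exact: dim_join_leq2.
- by rewrite memvE addvSl.
- by apply/negP; rewrite memvE -(frame_vertex fr); apply: Ag.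
- by apply: memv_add; rewrite ?rpredN memv_line.
- exact: frame_sub fr _ _.
- have := pair_neq0 1 ql fr pq (y := -1).
  by rewrite scale1r scaleN1r; apply; rewrite oppr_eq0 oner_eq0.
Qed.

(** Adding [w s *: v j] to the relation of the frame separates it into a combination of
[v j] and [v k], on [A_j A_k], and one of [v i] and [v j - v s], on [A_i U_js]. *)
Lemma sharygin_vector (R : realType) (A : 'I_4 -> subspace R) (g : subspace R)
    v w i j k s :
  ql_pair A g -> weighted_frame A g v w -> uniq [:: i; j; k; s] ->
  sharygin A g i j k s = <[(w j + w s) *: v j + w k *: v k]>%VS.
Proof.
move=> ql fr Hu.
have [Hijk [jk js]] : uniq [:: i; j; k] /\ j != k /\ j != s.
  by move: Hu; rewrite /= !inE !negb_or => /and4P[/and3P[-> -> _] /andP[-> ->] _ _].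
rewrite /sharygin /meet (U_vector ql fr js) !(frame_vertex fr).
apply: (@capv_vline _ _ _ _ (v i)).
- exact: dim_join_leq2.
- by rewrite memvE addvSl.
- exact: vertices_notin ql fr Hijk.
- have -> : (w j + w s) *: v j + w k *: v k =
            - w i *: v i + w s *: (v j - v s).
    apply/eqP; rewrite -subr_eq0 -(frame_relation fr) (sum_ord4 _ Hu).
    by apply/eqP/rowP => n; rewrite !mxE; ring.
  by apply: memv_add; rewrite rpredZ ?memv_line.
- by apply: memv_add; rewrite rpredZ ?memv_line.
- exact: pair_neq0 ql fr jk (frame_weight_neq0 fr k).
Qed.

(** * Conics in coordinates *)

(** The factor 2 comes from symmetrising: the symmetric matrix is the sum of the
two rank-one matrices with quadratic form [f * h]. *)
Lemma form_product_matrix (K : fieldType) n (f h : {scalar 'rV[K]_n}) :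
  exists Q : 'M[K]_n, Q^T = Q /\
    forall x, x *m Q *m x^T = (2 * (f x * h x))%:M.
Proof.
pose col (e : {scalar 'rV[K]_n}) := \col_m e (delta_mx 0 m).
have colE (e : {scalar 'rV[K]_n}) x : x *m col e = (e x)%:M.
  apply/matrixP => a b; rewrite !ord1 !mxE mulr1n [in RHS](row_sum_delta x).
  by rewrite linear_sum; apply: eq_bigr => m _; rewrite linearZ mxE.
exists (col f *m (col h)^T + col h *m (col f)^T); split.
  by rewrite linearD /= !trmx_mul !trmxK addrC.
move=> x; rewrite mulmxDr mulmxDl !mulmxA !colE -!mulmxA -!trmx_mul !colE.
by rewrite !tr_scalar_mx -!scalar_mxM -raddfD /=; congr _%:M; ring.
Qed.

(** The missing [x * x] and [y * y] terms make the conic pass through [a] and [b]. *)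
Lemma quadratic_form_matrix (K : fieldType) (a b c : 'rV[K]_3) (p q r t : K) :
  basis_of fullv [:: a; b; c] ->
  exists Q : 'M[K]_3, Q^T = Q /\
    forall x y z (u := x *: a + y *: b + z *: c),
      u *m Q *m u^T =
        (2 * (p * (x * y) + r * (y * z) + t * (x * z) + q * (z * z)))%:M.
Proof.
move=> basis; pose X := [tuple a; b; c].
pose f n : {scalar 'rV[K]_3} := coord X n.
have fE (n m : 'I_3) : f n X`_m = (n == m)%:R.
  by rewrite eq_sym; apply: (coord_free _ _ (basis_free basis)).
pose n0 : 'I_3 := inord 0; pose n1 : 'I_3 := inord 1; pose n2 : 'I_3 := inord 2.
have fu n x y z : f n (x *: a + y *: b + z *: c) =
    x * (n == n0)%:R + y * (n == n1)%:R + z * (n == n2)%:R.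
  by rewrite -!fE /= !inordK // !linearD !linearZ.
have [Qxy [Sxy Exy]] := form_product_matrix (f n0) (f n1).
have [Qyz [Syz Eyz]] := form_product_matrix (f n1) (f n2).
have [Qxz [Sxz Exz]] := form_product_matrix (f n0) (f n2).
have [Qzz [Szz Ezz]] := form_product_matrix (f n2) (f n2).
exists (p *: Qxy + r *: Qyz + t *: Qxz + q *: Qzz); split.
  by rewrite !linearD !linearZ /= Sxy Syz Sxz Szz.
move=> x y z u; have {}fu n := fu n x y z; rewrite -/u in fu.
(* From here on [u] matters only through its coordinates [fu]. *)
move: u fu => u fu; rewrite !mulmxDr !mulmxDl -!scalemxAr -!scalemxAl.
rewrite Exy Eyz Exz Ezz !scale_scalar_mx -!raddfD /= !fu -!val_eqE /= !inordK //=.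
by congr _%:M; ring.
Qed.

Theorem proposition2 (R : realType) (A : 'I_4 -> subspace R) (g : subspace R)
    (i j k s : 'I_4) :
  ql_pair A g ->
  uniq [:: i; j; k; s] ->
  exists C : subspace R -> Prop,
    conic_section C /\
    C (A i) /\ C (A j) /\
    C (sharygin A g i j k s) /\ C (sharygin A g i j s k) /\
    C (sharygin A g j i k s) /\ C (sharygin A g j i s k).
Proof.
move=> ql Hu; have [v [w fr]] := exists_weighted_frame ql.
have ne : [/\ i != j, i != k, i != s, j != k & j != s] /\ k != s.
  by move: Hu; rewrite /= !inE !negb_or => /and4P[/and3P[-> -> ->] /andP[-> ->] ->].
case: ne => -[ij ik is_ jk js] ks.
have distinct := (negbTE ij, negbTE ik, negbTE is_, negbTE jk, negbTE js,
  negbTE ks, eq_sym j i, eq_sym k i, eq_sym s i, eq_sym k j, eq_sym s j, eq_sym s k).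
have [[pts ncol] _ _ _] := ql.
have basis : basis_of fullv [:: v i; v j; v k].
  apply: not_collinear_basis; rewrite -!(frame_vertex fr); apply: ncol.
  by move: Hu; rewrite -[X in uniq X]/([:: i; j; k] ++ [:: s]) cat_uniq => /and3P[].
pose co_xz := w k * (w i + w k); pose co_yz := w k * (w j + w k).
have [Q [symQ QE]] :=
  quadratic_form_matrix (co_yz + co_xz) ((w i + w k) * (w j + w k)) co_yz co_xz basis.
pose C X := is_point X /\ forall x, x \in X -> x *m Q *m x^T = 0.
have onC x y z u : is_point <[u]>%VS ->
    u = x *: v i + y *: v j + z *: v k ->
    (co_yz + co_xz) * (x * y) + co_yz * (y * z) + co_xz * (x * z)
      + (w i + w k) * (w j + w k) * (z * z) = 0 ->
    C <[u]>%VS.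
  move=> pt uE E; split=> // _ /vlineP[l ->]; rewrite uE.
  by rewrite linearZ /= -scalemxAr -!scalemxAl QE E mulr0 raddf0 !scaler0.
have pt p q c : p != q -> is_point <[c *: v p + w q *: v q]>%VS.
  by move=> pq; rewrite /is_point dim_vline (pair_neq0 _ ql fr pq (frame_weight_neq0 fr q)).
have wE : w s = - (w i + w j + w k).
  apply/eqP; rewrite eq_sym -subr_eq0 -oppr_eq0 opprB opprK addrC.
  by rewrite -(sum_ord4 w Hu) (frame_weight_sum fr).
have vE : w s *: v s = - (w i *: v i + w j *: v j + w k *: v k).
  apply/eqP; rewrite -addr_eq0 addrC.
  by rewrite -(sum_ord4 (fun p => w p *: v p) Hu) (frame_relation fr).
exists C; refine (conj _ (conj _ (conj _ (conj _ (conj _ (conj _ _)))))).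
- exists Q; split=> //.
  (* At [v k] the form takes the value [2 (w i + w k) (w j + w k)]. *)
  apply/eqP => Q0; have /= := QE 0 0 1.
  rewrite Q0 mulmx0 mul0mx => /matrixP/(_ 0 0); rewrite !mxE eqxx mulr1n => /esym/eqP.
  rewrite !(mul0r, mulr0, add0r, mulr1) !mulf_eq0 pnatr_eq0 /=; apply/negP.
  have uikjs : uniq [:: i; k; j; s] by rewrite /= !inE !distinct.
  have ujkis : uniq [:: j; k; i; s] by rewrite /= !inE !distinct.
  by rewrite !negb_or (pair_weight_neq0 ql fr uikjs) (pair_weight_neq0 ql fr ujkis).
- rewrite (frame_vertex fr); apply: (onC 1 0 0).
  + by rewrite -(frame_vertex fr); apply: pts.
  + by rewrite scale1r !scale0r !addr0.
  + by ring.
- rewrite (frame_vertex fr); apply: (onC 0 1 0).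
  + by rewrite -(frame_vertex fr); apply: pts.
  + by rewrite scale1r !scale0r add0r addr0.
  + by ring.
- rewrite (sharygin_vector ql fr Hu).
  apply: (onC 0 (w j + w s) (w k)); first exact: pt.
    by rewrite scale0r add0r.
  by rewrite wE /co_yz /co_xz; ring.
- have uijsk : uniq [:: i; j; s; k] by rewrite /= !inE !distinct.
  rewrite (sharygin_vector ql fr uijsk).
  (* The relation of the frame expresses [w s *: v s] in the basis. *)
  apply: (onC (- w i) (w k) (- w k)); first exact: pt.
    by rewrite vE; apply/rowP => n; rewrite !mxE; ring.
  by rewrite /co_yz /co_xz; ring.
- have ujiks : uniq [:: j; i; k; s] by rewrite /= !inE !distinct.
  rewrite (sharygin_vector ql fr ujiks).
  apply: (onC (w i + w s) 0 (w k)); first exact: pt.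
    by rewrite scale0r addr0.
  by rewrite wE /co_yz /co_xz; ring.
- have ujisk : uniq [:: j; i; s; k] by rewrite /= !inE !distinct.
  rewrite (sharygin_vector ql fr ujisk).
  apply: (onC (w k) (- w j) (- w k)); first exact: pt.
    by rewrite vE; apply/rowP => n; rewrite !mxE; ring.
  by rewrite /co_yz /co_xz; ring.
Qed.
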